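(* Let $F\in\mathcal{H}^d$ with homogeneity matrix $A$ and let $\mathbf{b}\in\mathbb{R}^d_{++}$ with $\sum_{i=1}^d b_i=1$. If either $A^\top\mathbf{b}=\mathbf{b}$, or $\rho(A)<1$ and $(A^\top\mathbf{b})_i\le b_i$ for every $i\in[d]$, then $$\inf_{\mathbf{u}\in\mathbb{S}_{++}}\ \prod_{i=1}^d\Big(\max_{j\in[n_i]}\frac{F_{i,j}(\mathbf{u})}{u_{i,j}}\Big)^{b_i}\;=\;r_{\mathbf{b}}(F)\;=\;\max_{\mathbf{v}\in\mathbb{S}_{+}}\ \prod_{i=1}^d\Big(\min_{j\in[n_i],\,v_{i,j}>0}\frac{F_{i,j}(\mathbf{v})}{v_{i,j}}\Big)^{b_i},$$ where in particular the maximum on the right is attained.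
   Context: Fix positive integers $d,n_1,\dots,n_d$ and write $[n]=\{1,\dots,n\}$. Let $V=\mathbb{R}^{n_1}\times\cdots\times\mathbb{R}^{n_d}$, $\mathcal{K}_+=\mathbb{R}^{n_1}_+\times\cdots\times\mathbb{R}^{n_d}_+$ (vectors with nonnegative entries), and let $\mathcal{K}_{++}$ be its interior (all entries positive). Elements are written $\mathbf{x}=(\mathbf{x}_1,\dots,\mathbf{x}_d)$ with $\mathbf{x}_i=(x_{i,1},\dots,x_{i,n_i})\in\mathbb{R}^{n_i}$; similarly $F_i=(F_{i,1},\dots,F_{i,n_i})$. Write $\mathbf{x}\le_{\mathcal{K}}\mathbf{y}$ if $\mathbf{y}-\mathbf{x}\in\mathcal{K}_+$. For $\boldsymbol{\alpha}\in\mathbb{R}^d$, $\mathbf{x}\in V$ set $\boldsymbol{\alpha}\otimes\mathbf{x}=(\alpha_1\mathbf{x}_1,\dots,\alpha_d\mathbf{x}_d)$. For $\boldsymbol{\alpha}\in\mathbb{R}^d_+$ and a nonnegative $d\times d$ matrix $A$ set $\boldsymbol{\alpha}^A=(\prod_k\alpha_k^{A_{1,k}},\dots,\prod_k\alpha_k^{A_{d,k}})$ (with $0^0=1$); $\rho(A)$ is the spectral radius of $A$. $\mathcal{H}^d$ is the set of continuous maps $F=(F_1,\dots,F_d):\mathcal{K}_+\to\mathcal{K}_+$ such that: (i) there is a nonnegative $d\times d$ matrix $A$ (the homogeneity matrix of $F$) with $F(\boldsymbol{\alpha}\otimes\mathbf{x})=\boldsymbol{\alpha}^A\otimes F(\mathbf{x})$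 for all $\boldsymbol{\alpha}\in\mathbb{R}^d_+$, $\mathbf{x}\in\mathcal{K}_+$; (ii) $F$ is order-preserving: $\mathbf{x}\le_{\mathcal{K}}\mathbf{y}$ implies $F(\mathbf{x})\le_{\mathcal{K}}F(\mathbf{y})$; (iii) $F$ is nondegenerate: $F(\mathcal{K}_{++})\subset\mathcal{K}_{++}$ and $A\mathbb{R}^d_{++}\subset\mathbb{R}^d_{++}$. Each $\mathbb{R}^{n_i}$ carries a fixed norm $\|\cdot\|_{\gamma_i}$ that is monotonic ($|\mathbf{x}_i|\le|\mathbf{y}_i|$ entrywise implies $\|\mathbf{x}_i\|_{\gamma_i}\le\|\mathbf{y}_i\|_{\gamma_i}$). $\mathbb{S}_+=\{\mathbf{x}\in\mathcal{K}_+:\|\mathbf{x}_i\|_{\gamma_i}=1\ \forall i\in[d]\}$ and $\mathbb{S}_{++}=\mathbb{S}_+\cap\mathcal{K}_{++}$. The spectral radius is $$r_{\mathbf{b}}(F)=\sup\Big\{\prod_{i=1}^d\lambda_i^{b_i}\ :\ F(\mathbf{x})=\boldsymbol{\lambda}\otimes\mathbf{x}\text{ for some }\mathbf{x}\in\mathbb{S}_+,\ \boldsymbol{\lambda}\in\mathbb{R}^d_+\Big\}.$$ *)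

(* Defs.v *)
From HB Require Import structures.
From mathcomp Require Import all_boot all_order all_algebra.
From mathcomp Require Import complex.
From mathcomp Require Import all_classical all_reals all_analysis.

Set Implicit Arguments.
Unset Strict Implicit.
Unset Printing Implicit Defensive.

Import Order.TTheory GRing.Theory Num.Theory.
Import numFieldNormedType.Exports.

Local Open Scope classical_set_scope.
Local Open Scope ring_scope.
Local Open Scope complex_scope.

(* R^{n_1} x ... x R^{n_d} with its product topology. *)
Notation prodspace R n :=
  (prod_topology (fun i : 'I__ => 'rV[R]_(n i)) : Type).

Section Cones.
Context {R : realType} {d : nat} {n : 'I_d -> nat}.
Implicit Types (x y : prodspace R n) (a : 'cV[R]_d).

Definition Kplus : set (prodspace R n) := [set x | forall i j, 0 <= x i 0 j].

Definition Kpplus : set (prodspace R n) := [set x | forall i j, 0 < x i 0 j].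

Definition leK x y : Prop := Kplus (fun i => y i - x i).

Definition otimes a x : prodspace R n := fun i => a i 0 *: x i.

End Cones.

Section Vectors.
Context {R : realType} {d : nat}.
Implicit Types (a : 'cV[R]_d) (A : 'M[R]_d).

Definition nonneg_vec : set 'cV[R]_d := [set a | forall i, 0 <= a i 0].

Definition pos_vec : set 'cV[R]_d := [set a | forall i, 0 < a i 0].

(* The library's real power satisfies 0 `^ 0 = 1, and 0 `^ t = 0 for t != 0. *)
Definition vpow a A : 'cV[R]_d := \col_i \prod_(k < d) (a k 0 `^ A i k).

(* For d = 0 there is no eigenvalue and this is the junk value sup set0 = 0. *)
Definition spectral_radius A : R :=
  sup [set r : R | exists2 z : R[i],
    eigenvalue (map_mx (real_complex R) A) z & `|z| = r%:C].

End Vectors.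

Record is_norm {R : realType} {m : nat} (N : 'rV[R]_m -> R) : Prop := IsNorm {
  norm_triangle : forall x y, N (x + y) <= N x + N y;
  norm_homog : forall (c : R) x, N (c *: x) = `|c| * N x;
  norm_definite : forall x, N x = 0 -> x = 0 }.

Definition monotonic_norm {R : realType} {m : nat} (N : 'rV[R]_m -> R) : Prop :=
  forall x y : 'rV[R]_m, (forall j, `|x 0 j| <= `|y 0 j|) -> N x <= N y.

(* A map of the cone is a total map on the whole space of which only the
   restriction to Kplus is constrained. *)
Record in_Hd {R : realType} {d : nat} {n : 'I_d -> nat}
    (F : prodspace R n -> prodspace R n) (A : 'M[R]_d) : Prop := InHd {
  Hd_maps : forall x, Kplus x -> Kplus (F x);
  Hd_continuous : {within Kplus, continuous F};
  Hd_mx_ge0 : forall i k, 0 <= A i k;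
  Hd_homog : forall (a : 'cV[R]_d) x, nonneg_vec a -> Kplus x ->
    F (otimes a x) = otimes (vpow a A) (F x);
  Hd_order : forall x y, Kplus x -> Kplus y -> leK x y -> leK (F x) (F y);
  Hd_pos : forall x, Kpplus x -> Kpplus (F x);
  Hd_mx_pos : forall a : 'cV[R]_d, pos_vec a -> pos_vec (A *m a) }.

Section SpectralRadius.
Context {R : realType} {d : nat} {n : 'I_d -> nat}.
Variable gamma : forall i : 'I_d, 'rV[R]_(n i) -> R.
Variables (F : prodspace R n -> prodspace R n) (b : 'cV[R]_d).

Definition Splus : set (prodspace R n) :=
  [set x | Kplus x /\ forall i, gamma (x i) = 1].

Definition Spplus : set (prodspace R n) := Splus `&` Kpplus.

(* Valued in \bar R: no convention is needed for an empty or unbounded set. *)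
Definition rb : \bar R :=
  ereal_sup [set (\prod_(i < d) (l i 0 `^ b i 0))%:E | l in
    [set l : 'cV[R]_d | nonneg_vec l /\
      exists2 x, Splus x & F x = otimes l x]].

(* The sup and inf below are over finite index sets, nonempty as soon as
   n i > 0 (resp. x i has a positive entry, as it does for x in Splus), so they
   are a maximum and a minimum. *)
Definition CW_max (x : prodspace R n) : R :=
  \prod_(i < d)
    (sup [set F x i 0 j / x i 0 j | j in [set: 'I_(n i)]] `^ b i 0).

Definition CW_min (x : prodspace R n) : R :=
  \prod_(i < d)
    (inf [set F x i 0 j / x i 0 j | j in [set j | 0 < x i 0 j]] `^ b i 0).

End SpectralRadius.

(* Main.v *)
Require Import Defs.
From HB Require Import structures.
From mathcomp Require Import all_boot all_order all_algebra.
From mathcomp Require Import all_classical all_reals all_analysis.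
From mathcomp Require Import ring lra.

Import Order.TTheory GRing.Theory Num.Theory.
Import numFieldNormedType.Exports.

Local Open Scope classical_set_scope.
Local Open Scope ring_scope.

(** Let A^T b <= b, which holds in both cases. If v is in S_+ and u in S_++, then
    v <= t (x) u with t_i = max_j v_ij / u_ij >= 1, and order preservation and
    homogeneity give CW_min v <= (prod_k t_k^((A^T b)_k - b_k)) CW_max u
    <= CW_max u. Every eigenvector x in S_+ satisfies CW_min x = prod_i l_i^b_i,
    so it remains to find an eigenvector whose eigenvalue product is at least the
    infimum of CW_max. For k > 0 the map y |-> F(y)^(1/(1+k)) (entrywise power)
    is a contraction of K_++ for the metric sum_i b_i max_j |ln x_ij - ln y_ij|;
    normalizing its approximate fixed points gives u in S_++ and l with
    F u <= l (x) u <= F u + e, and hence CW_max u <= prod_i l_i^b_i. A limit along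
    an ultrafilter as e -> 0 is the eigenpair. *)

Set Implicit Arguments.
Unset Strict Implicit.
Unset Printing Implicit Defensive.

Lemma ord_argmax (R : realType) (m : nat) (f : 'I_m -> R) :
  (0 < m)%N -> exists j, forall j', f j' <= f j.
Proof.
case: m f => // m f _.
by case: (@arg_maxP _ _ _ ord0 xpredT f isT) => j _ jP; exists j => j'; exact: jP.
Qed.

(** * Monotonic norms on a single factor *)

Section Norms.
Context {R : realType} {m : nat} {N : 'rV[R]_m -> R}.
Hypotheses (Nnorm : is_norm N) (Nmono : monotonic_norm N).

Lemma norm_zero : N 0 = 0.
Proof. by rewrite -[0](scale0r (0 : 'rV[R]_m)) (norm_homog Nnorm) normr0 mul0r. Qed.

Lemma norm_nonneg (x : 'rV[R]_m) : 0 <= N x.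
Proof.
have := norm_triangle Nnorm x (- x).
rewrite subrr norm_zero -(scaleN1r x) (norm_homog Nnorm) normrN normr1 mul1r.
by rewrite -mulr2n pmulrn_lge0.
Qed.

Lemma norm_pos (x : 'rV[R]_m) j : x 0 j != 0 -> 0 < N x.
Proof.
move=> xj; rewrite lt_neqAle norm_nonneg andbT eq_sym.
by apply: contra xj => /eqP/(norm_definite Nnorm) ->; rewrite mxE.
Qed.

Lemma norm_le_sum (x : 'rV[R]_m) : N x <= \sum_j `|x 0 j| * N (delta_mx 0 j).
Proof.
rewrite {1}(row_sum_delta x).
elim/big_ind2: _ => [|y1 t1 y2 t2 h1 h2|j _].
- by rewrite norm_zero.
- by apply: le_trans (norm_triangle Nnorm _ _) _; exact: lerD.
- by rewrite (norm_homog Nnorm).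
Qed.

(** Monotonicity allows every entry of [x] except the [j]-th to be replaced by 0. On the unit sphere
    this bounds each entry by the inverse norm of a unit row. *)
Lemma norm_ge_coord (x : 'rV[R]_m) j : `|x 0 j| * N (delta_mx 0 j) <= N x.
Proof.
rewrite -(norm_homog Nnorm); apply: Nmono => j'.
by rewrite !mxE eqxx /=; case: eqP => [->|_]; rewrite ?mulr1 ?mulr0 ?normr0.
Qed.

Lemma norm_dist (x y : 'rV[R]_m) : `|N x - N y| <= N (x - y).
Proof.
have sub u v : N u - N v <= N (u - v).
  by rewrite lerBlDr; have := norm_triangle Nnorm (u - v) v; rewrite subrK.
rewrite ler_norml sub andbT lerNl opprB.
by have := sub y x; rewrite -(opprB x y) -(scaleN1r (x - y)) (norm_homog Nnorm) normrN normr1 mul1r.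
Qed.

End Norms.

Lemma norm_delta_gt0 (R : realType) m (N : 'rV[R]_m -> R) (j : 'I_m) :
  is_norm N -> 0 < N (delta_mx 0 j).
Proof. by move=> Nn; apply: (@norm_pos _ _ _ Nn _ j); rewrite mxE !eqxx oner_eq0. Qed.

(** * Limits along filters and ultrafilters *)

Section Limits.
Context {T : Type} {G : set_system T} {R : realType}.

(** Compactness of the segment gives a cluster point, and for an ultrafilter a cluster point is a
    limit: the preimage of a neighbourhood or that of its complement belongs to [G], and the latter
    is excluded. *)
Lemma ultra_bounded_cvg (UG : UltraFilter G) (f : T -> R) (lo up : R) :
  (forall t, lo <= f t <= up) -> exists p : R, f t @[t --> G] --> p.
Proof.
move=> fb.
have [|p [_ clp]] := @segment_compact R lo up (fmap f G) _.
  by apply: (@filterS _ G _ setT) => [t _|];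
    [rewrite /= in_itv; exact: fb|exact: filterT].
exists p => B Bp.
have [//|nB] := in_ultra_setVsetC (f @^-1` B) UG.
by have [x [] /[apply]] := clp (~` B) B nB Bp.
Qed.

Lemma cvg_le {PG : ProperFilter G} (f g : T -> R) (l l' : R) :
  f t @[t --> G] --> l -> g t @[t --> G] --> l' -> (forall t, f t <= g t) ->
  l <= l'.
Proof.
move=> fl gl fg; rewrite -subr_ge0; apply: cvgr_to_ge (cvgB gl fl) _.
by apply: nearW => t; rewrite /= subr_ge0.
Qed.

Lemma powR_cvg {FG : Filter G} (f : T -> R) (l e : R) : 0 < e ->
  (forall t, 0 <= f t) -> 0 <= l ->
  f t @[t --> G] --> l -> f t `^ e @[t --> G] --> l `^ e.
Proof.
move=> e0 f0; rewrite le_eqVlt => /predU1P[<-|l0] fl.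
  (* At [l = 0] the logarithm is of no help; eventually [f t] is at most [r] to the power [e^-1],
     which suffices. *)
  rewrite powR0 ?gt_eqF//; apply/cvgrPdist_le => r r0.
  have : \forall t \near G, f t <= r `^ e^-1.
    by apply: (cvgr_le _ fl); rewrite powR_gt0.
  apply: filterS => t ft.
  rewrite sub0r normrN ger0_norm ?powR_ge0//.
  apply: (@le_trans _ _ ((r `^ e^-1) `^ e)).
    by apply: ge0_ler_powR; rewrite ?nnegrE ?powR_ge0 ?(ltW e0).
  by rewrite -powRrM mulVf ?gt_eqF// powRr1// ltW.
have cont : {for l, continuous (fun x : R => expR (e * ln x))}.
  apply: continuous_comp; last exact: continuous_expR.
  by apply: cvgMr; exact: continuous_ln.
have E x : 0 < x -> x `^ e = expR (e * ln x) by move=> x0; rewrite /powR gt_eqF.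
rewrite (E l l0).
have fp : \forall t \near G, 0 < f t by exact: (cvgr_gt _ fl).
apply: cvg_trans (continuous_cvg _ cont fl).
apply: near_eq_cvg; apply: filterS fp => t ft /=; by rewrite E.
Qed.

Lemma cvg_prodspace {FG : Filter G} d (n : 'I_d -> nat)
    (x : T -> prodspace R n) (p : prodspace R n) :
  (forall i j, x t i 0 j @[t --> G] --> p i 0 j) -> x t @[t --> G] --> p.
Proof.
(* The product topology is the supremum of the topologies induced by the projections, so each factor
   is tested separately. *)
move=> xp; apply/cvg_sup => i N [V] [[W] oW <-] WfN WU.
apply: (filterS WU).
have [B nB sB] : nbhs (p i) W by exact: open_nbhs_nbhs.
suff : \forall t \near G, forall j, B 0 j (x t i 0 j).
  by apply: filterS => t Bt /=; apply: sB => k l; rewrite ord1; exact: Bt.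
apply: filter_forall => j; exact: xp (nB 0 j).
Qed.

Lemma cvg_coord {FG : Filter G} d (n : 'I_d -> nat)
    (x : T -> prodspace R n) (p : prodspace R n) :
  x t @[t --> G] --> p -> forall i j, x t i 0 j @[t --> G] --> p i 0 j.
Proof.
move=> xp i j.
have xi : x t i @[t --> G] --> p i.
  exact: (@cvg_comp _ _ _ x (fun y : prodspace R n => y i) _ _ _ xp
    (@proj_continuous _ (fun i => 'rV[R]_(n i) : topologicalType) i p)).
exact: (@cvg_comp _ _ _ (fun t => x t i) (fun y : 'rV[R]_(n i) => y 0 j) _ _ _ xi
  (@coord_continuous R 1 (n i) 0 j (p i))).
Qed.

(** The distance from [c] to [N p] is at most [N (x t - p)], hence at most a weighted sum of
    coordinate distances that tends to 0. *)
Lemma norm_cvg_cst {PG : ProperFilter G} m (N : 'rV[R]_m -> R) (c : R)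
    (x : T -> 'rV[R]_m) (p : 'rV[R]_m) : is_norm N ->
  (forall j, x t 0 j @[t --> G] --> p 0 j) -> (forall t, N (x t) = c) -> N p = c.
Proof.
move=> Nn xp Nx.
have sum0 : \sum_j `|x t 0 j - p 0 j| * N (delta_mx 0 j) @[t --> G] -->
    \sum_j `|p 0 j - p 0 j| * N (delta_mx 0 j).
  apply: cvg_big => [|j _]; first exact: add_continuous.
  apply: cvgMl; apply: cvg_norm; apply: cvgB; [exact: xp|exact: cvg_cst].
apply/eqP; rewrite eq_sym -subr_eq0 -normr_le0.
rewrite -[leRHS](_ : \sum_j `|p 0 j - p 0 j| * N (delta_mx 0 j) = 0); last first.
  by apply: big1 => j _; rewrite subrr normr0 mul0r.
apply: (cvg_le (cvg_cst _) sum0) => t; rewrite -(Nx t).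
apply: le_trans (norm_dist Nn _ _) _; apply: le_trans (norm_le_sum Nn _) _.
by apply: ler_sum => j _; rewrite !mxE.
Qed.

End Limits.

(** * Order and homogeneity of [F] in logarithmic coordinates *)

Section CollatzWielandt.
Context {R : realType} {d : nat} {n : 'I_d -> nat}.
Hypothesis n_gt0 : forall i, (0 < n i)%N.
Context {gamma : forall i : 'I_d, 'rV[R]_(n i) -> R}.
Arguments gamma : clear implicits.
Hypothesis gamma_norm : forall i, is_norm (gamma i).
Hypothesis gamma_mono : forall i, monotonic_norm (gamma i).
Context {F : prodspace R n -> prodspace R n} {A : 'M[R]_d}.
Hypothesis FA : in_Hd F A.
Context {b : 'cV[R]_d}.
Hypothesis b_gt0 : forall i, 0 < b i 0.
Hypothesis Ab : forall k, \sum_i b i 0 * A i k <= b k 0.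

Lemma Kpplus_Kplus (x : prodspace R n) : Kpplus x -> Kplus x.
Proof. by move=> xP i j; exact: ltW. Qed.

Lemma F_le (x y : prodspace R n) : Kplus x -> Kplus y ->
  (forall i j, x i 0 j <= y i 0 j) -> forall i j, F x i 0 j <= F y i 0 j.
Proof.
move=> x0 y0 xy i j.
have /(Hd_order FA x0 y0)/(_ i j) : leK x y.
  by move=> k l; rewrite !mxE subr_ge0.
by rewrite !mxE subr_ge0.
Qed.

(** With scalars written as exponentials, the monomial action of [A] becomes linear in [t]. *)
Lemma F_scale (x : prodspace R n) (t : 'I_d -> R) : Kplus x ->
  forall i j, F (otimes (\col_k expR (t k)) x) i 0 j =
    expR (\sum_k A i k * t k) * F x i 0 j.
Proof.
move=> x0 i j; rewrite (Hd_homog FA) //; last by move=> k; rewrite mxE expR_ge0.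
rewrite /otimes /vpow !mxE; congr (_ * _).
rewrite expR_sum; apply: eq_bigr => k _.
by rewrite mxE -expRM mulrC.
Qed.

Lemma F_expand (x y : prodspace R n) (t : 'I_d -> R) : Kplus x -> Kplus y ->
  (forall i j, x i 0 j <= expR (t i) * y i 0 j) ->
  forall i j, F x i 0 j <= expR (\sum_k A i k * t k) * F y i 0 j.
Proof.
move=> x0 y0 xy i j; rewrite -F_scale//; apply: F_le => //.
  by move=> k l; rewrite !mxE mulr_ge0 ?expR_ge0 ?y0.
by move=> k l; rewrite !mxE.
Qed.

(** Exchanging the sums reduces this to [Ab] weighted by [t]. It drives both the weak duality and
    the contraction estimate. *)
Lemma sum_weight (t : 'I_d -> R) : (forall i, 0 <= t i) ->
  \sum_i b i 0 * (\sum_k A i k * t k) <= \sum_i b i 0 * t i.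
Proof.
move=> t0; under eq_bigr do rewrite big_distrr /=.
rewrite exchange_big /=; apply: ler_sum => k _.
under eq_bigr do rewrite mulrA.
by rewrite -big_distrl /=; apply: ler_wpM2r.
Qed.

(** * Collatz-Wielandt quotients and weak duality *)

Lemma le_row_sup (u : prodspace R n) i j :
  F u i 0 j / u i 0 j <= sup [set F u i 0 j / u i 0 j | j in [set: 'I_(n i)]].
Proof.
apply: ub_le_sup; last by exists j.
have [j0 j0P] := @ord_argmax R _ (fun j => F u i 0 j / u i 0 j) (n_gt0 i).
by exists (F u i 0 j0 / u i 0 j0) => _ [j' _ <-]; exact: j0P.
Qed.

Lemma row_inf_le (v : prodspace R n) i j : Kplus v -> 0 < v i 0 j ->
  inf [set F v i 0 j / v i 0 j | j in [set j | 0 < v i 0 j]] <= F v i 0 j / v i 0 j.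
Proof.
move=> v0 vj; apply: ge_inf; last by exists j.
by exists 0 => _ [j' _ <-]; rewrite divr_ge0 ?v0 ?(Hd_maps FA).
Qed.

Lemma row_inf_ge0 (v : prodspace R n) i : Kplus v ->
  0 <= inf [set F v i 0 j / v i 0 j | j in [set j | 0 < v i 0 j]].
Proof.
move=> v0; set E := (X in inf X).
(* For a general [v] in the cone [E] may be empty, and then [inf] takes its default value 0. *)
have [->|/set0P ne] := eqVneq E set0; first by rewrite inf0.
apply: lb_le_inf => // _ [j' _ <-]; apply: divr_ge0; [exact: (Hd_maps FA)|exact: v0].
Qed.

Lemma Splus_pos {v : prodspace R n} (vS : Splus gamma v) i : exists j, 0 < v i 0 j.
Proof.
apply: contrapT => /forallNP vN.
have := vS.2 i; suff -> : v i = 0.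
  by rewrite (norm_zero (gamma_norm i)) => /eqP; rewrite eq_sym oner_eq0.
apply/rowP => j; rewrite mxE; apply: le_anti; rewrite vS.1 andbT leNgt.
by apply/negP/vN.
Qed.

Lemma weak_duality (v u : prodspace R n) :
  Splus gamma v -> Spplus gamma u -> CW_min F b v <= CW_max F b u.
Proof.
move=> vS [uS u0].
have [j jP] : exists j : forall i, 'I_(n i),
    forall i j', v i 0 j' / u i 0 j' <= v i 0 (j i) / u i 0 (j i).
  have P i := cid (@ord_argmax R _ (fun j => v i 0 j / u i 0 j) (n_gt0 i)).
  by exists (fun i => projT1 (P i)) => i; exact: projT2 (P i).
have vj i : 0 < v i 0 (j i).
  have [j0 j0P] := Splus_pos vS i; rewrite -(pmulr_lgt0 (x := (u i 0 (j i))^-1)) ?invr_gt0//.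
  by rewrite (lt_le_trans _ (jP i j0))// divr_gt0.
(* [expR (t i)] is the least factor that lifts [u i] above [v i], attained at [j i]. *)
pose t i := ln (v i 0 (j i) / u i 0 (j i)).
have tE i : expR (t i) = v i 0 (j i) / u i 0 (j i) by rewrite lnK// posrE divr_gt0.
have vu i j' : v i 0 j' <= expR (t i) * u i 0 j' by rewrite tE -ler_pdivrMr.
(* Both rows have norm 1, so monotonicity of the norm forces the factor to be at least 1. *)
have t0 i : 0 <= t i.
  rewrite ln_ge0// -tE.
  have : gamma i (v i) <= gamma i (expR (t i) *: u i).
    apply: gamma_mono => j'; rewrite mxE !ger0_norm ?vS.1//.
    by rewrite mulr_ge0 ?expR_ge0 ?uS.1.
  by rewrite (norm_homog (gamma_norm i)) vS.2 uS.2 mulr1 ger0_norm ?expR_ge0.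
pose s i := sup [set F u i 0 j / u i 0 j | j in [set: 'I_(n i)]].
have sF i j' : F u i 0 j' / u i 0 j' <= s i := le_row_sup u j'.
have s0 i : 0 <= s i.
  by apply: le_trans (sF i (j i)); rewrite divr_ge0 ?uS.1 ?(Hd_maps FA)//; exact: uS.1.
(* The term [- t i] comes from dividing by [v i 0 (j i)], which equals [expR (t i) * u i 0 (j i)]
   exactly. *)
pose r i := \sum_k A i k * t k - t i.
apply: (@le_trans _ _ (\prod_i ((expR (r i) * s i) `^ b i 0))).
  apply: ler_prod => i _; rewrite powR_ge0 /=.
  apply: ge0_ler_powR; rewrite ?nnegrE ?(ltW (b_gt0 i)) ?row_inf_ge0//; first exact: vS.1.
    by rewrite mulr_ge0 ?expR_ge0.
  apply: (le_trans (row_inf_le vS.1 (vj i))).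
  rewrite ler_pdivrMr// /r expRB tE.
  apply: (le_trans (F_expand vS.1 uS.1 vu (j i))).
  rewrite -!mulrA ler_wpM2l ?expR_ge0//.
  have -> : (v i 0 (j i) / u i 0 (j i))^-1 * (s i * v i 0 (j i)) = s i * u i 0 (j i).
    by field; rewrite !gt_eqF.
  by rewrite -ler_pdivrMr.
under eq_bigr do rewrite powRM ?expR_ge0// -expRM.
rewrite big_split /= -expR_sum -[leRHS]mul1r ler_wpM2r//.
  by apply: prodr_ge0 => i _; exact: powR_ge0.
rewrite -expR0 ler_expR.
(* The exponent left over is the [b]-weighted sum of the [r i]. *)
have := sum_weight t0; rewrite -subr_le0 -sumrB; congr (_ <= _).
by apply: eq_bigr => i _; rewrite /r; ring.
Qed.

(** All quotients at positive entries of row [i] equal [l i], and norm 1 guarantees such an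
    entry. *)
Lemma CW_min_eigen (v : prodspace R n) (l : 'cV[R]_d) :
  Splus gamma v -> F v = otimes l v -> CW_min F b v = \prod_i (l i 0 `^ b i 0).
Proof.
move=> vS Fv; apply: eq_bigr => i _; congr (_ `^ _).
rewrite (_ : [set _ | _ in _] = [set l i 0]) ?inf1//.
rewrite Fv; apply/seteqP; split => [_ [j vj <-]|_ ->].
  by rewrite /otimes mxE mulfK// gt_eqF.
by have [j vj] := Splus_pos vS i; exists j => //; rewrite /otimes mxE mulfK// gt_eqF.
Qed.

Lemma CW_max_le (u : prodspace R n) (l : 'cV[R]_d) : Kpplus u ->
  (forall i j, F u i 0 j <= l i 0 * u i 0 j) ->
  CW_max F b u <= \prod_i (l i 0 `^ b i 0).
Proof.
move=> u0 ul; apply: ler_prod => i _; rewrite powR_ge0 /=.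
have F0 j : 0 <= F u i 0 j / u i 0 j.
  by rewrite divr_ge0 ?(Kpplus_Kplus u0)// (Hd_maps FA)//; exact: Kpplus_Kplus.
have le_l j : F u i 0 j / u i 0 j <= l i 0 by rewrite ler_pdivrMr.
apply: ge0_ler_powR; rewrite ?nnegrE ?(ltW (b_gt0 i))//.
- by apply: le_trans (le_row_sup u (Ordinal (n_gt0 i))); exact: F0.
- exact: le_trans (F0 (Ordinal (n_gt0 i))) (le_l _).
- apply: ge_sup => [|_ [j _ <-]]; last exact: le_l.
  by apply: image_nonempty; exists (Ordinal (n_gt0 i)).
Qed.

(** * Approximate eigenvectors in the open cone *)

Lemma F_ln_dist (x y : prodspace R n) (t : 'I_d -> R) : Kpplus x -> Kpplus y ->
  (forall i j, `|ln (x i 0 j) - ln (y i 0 j)| <= t i) ->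
  forall i j, `|ln (F x i 0 j) - ln (F y i 0 j)| <= \sum_k A i k * t k.
Proof.
(* Exchanging [x] and [y] gives the other side; the one-sided bound is [F_expand] after
   exponentiation. *)
suff oneside : forall x y : prodspace R n, Kpplus x -> Kpplus y ->
    (forall i j, ln (x i 0 j) - ln (y i 0 j) <= t i) ->
    forall i j, ln (F x i 0 j) - ln (F y i 0 j) <= \sum_k A i k * t k.
  move=> x0 y0 xy i j; rewrite ler_norml lerNl opprB !oneside// => k l.
    by rewrite (le_trans (ler_norm _) (xy k l)).
  by have := xy k l; rewrite distrC => /(le_trans (ler_norm _)).
move=> {}x {}y x0 y0 xy i j.
have Fx := Hd_pos FA x0 j; have Fy := Hd_pos FA y0 j.
rewrite lerBlDr -ler_expR expRD !lnK ?posrE//.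
apply: (F_expand (Kpplus_Kplus x0) (Kpplus_Kplus y0)) => k l.
by rewrite -[x k 0 l]lnK ?posrE// -[y k 0 l]lnK ?posrE// -expRD ler_expR -lerBlDr.
Qed.

Lemma approx_power_fixpoint (k : R) : 0 < k ->
  exists2 y : prodspace R n, Kpplus y &
    forall i j, `|ln (F y i 0 j) - (1 + k) * ln (y i 0 j)| <= k.
Proof.
move=> k0; pose q := (1 + k)^-1.
have k1 : 0 < 1 + k by lra.
have q0 : 0 < q by rewrite invr_gt0.
have q1 : q < 1 by rewrite invf_lt1//; lra.
pose step (y : prodspace R n) : prodspace R n := fun i => \row_j (F y i 0 j `^ q).
have step0 y : Kpplus y -> Kpplus (step y).
  by move=> y0 i j; rewrite mxE powR_gt0// (Hd_pos FA).
have ln_step y i j : ln (step y i 0 j) = q * ln (F y i 0 j) by rewrite mxE ln_powR.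
pose Y m := iter m step (fun i => const_mx 1).
have Y0 m : Kpplus (Y m).
  by elim: m => [i j|m IH] /=; [rewrite mxE|exact: step0].
(* [T m] bounds the logarithmic displacement of the [m]-th iterate, factor by factor; the initial
   sum over [j] dominates every entry. *)
pose T m := iter m (fun (t : 'I_d -> R) i => q * \sum_k A i k * t k)
  (fun i => \sum_j `|ln (Y 1%N i 0 j) - ln (Y 0%N i 0 j)|).
have T0 m i : 0 <= T m i.
  elim: m i => [|m IH] i /=; first by rewrite sumr_ge0.
  apply: mulr_ge0; [exact: ltW|apply: sumr_ge0 => l _].
  by rewrite mulr_ge0 ?(Hd_mx_ge0 FA).
have YT m i j : `|ln (Y m.+1 i 0 j) - ln (Y m i 0 j)| <= T m i.
  elim: m i j => [|m IH] i j.
    by rewrite /T /= (bigD1 j)//= lerDl sumr_ge0.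
  rewrite /Y iterS -/(Y m.+1) [Y m.+1 in X in _ - X]iterS -/(Y m) !ln_step -mulrBr.
  by rewrite normrM gtr0_norm// /= ler_pM2l//; exact: (F_ln_dist (Y0 m.+1) (Y0 m) IH).
pose S := \sum_i b i 0 * T 0%N i.
have S_T m : \sum_i b i 0 * T m i <= q ^+ m * S.
  elim: m => [|m IH]; first by rewrite mul1r.
  rewrite exprS -mulrA; apply: le_trans (ler_wpM2l (ltW q0) IH).
  apply: le_trans (ler_wpM2l (ltW q0) (sum_weight (T0 m))).
  by rewrite mulr_sumr /=; under eq_bigr do rewrite mulrCA.
(* As [b] is positive, each coordinate of [T m] is recovered from the weighted sum at the cost of
   the factor [B]. *)
pose B := \sum_i (b i 0)^-1.
have TB m i : T m i <= (B * S) * q ^+ m.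
  have -> : T m i = (b i 0)^-1 * (b i 0 * T m i) by rewrite mulKf// gt_eqF.
  rewrite -mulrA; apply: ler_pM; rewrite ?invr_ge0 ?mulr_ge0 ?(ltW (b_gt0 i))//.
    by rewrite /B (bigD1 i)//= lerDl sumr_ge0// => l _; rewrite invr_ge0 ltW.
  rewrite [S * _]mulrC; apply: le_trans (S_T m).
  by rewrite [leRHS](bigD1 i)//= lerDl sumr_ge0// => l _; rewrite mulr_ge0// ltW.
have qlim : geometric (B * S) q m @[m --> \oo] --> 0.
  by apply: cvg_geometric; rewrite gtr0_norm.
(* The iteration stops once the displacement is at most [q * k]; multiplying by [1 + k] then gives
   the bound [k]. *)
have [m Tm] : exists m, (B * S) * q ^+ m <= q * k.
  have qk : 0 < q * k by rewrite mulr_gt0.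
  have [m _ /(_ m (leqnn m))] := cvgr_le _ qlim _ qk.
  by exists m.
exists (Y m) => // i j.
have := le_trans (YT m i j) (le_trans (TB m i) Tm).
rewrite /Y iterS -/(Y m) ln_step -(ler_pM2l k1) -{1}(gtr0_norm k1) -normrM mulrBr !mulrA.
by rewrite /q mulfV ?gt_eqF// !mul1r.
Qed.

(** Normalizing shifts [ln (y i 0 j)] and [ln (F y i 0 j)] by amounts independent of [j], which
    [c i] absorbs. *)
Lemma approx_power_eigen (k : R) : 0 < k ->
  exists u : prodspace R n, Spplus gamma u /\ exists c : 'I_d -> R,
    forall i j, `|ln (F u i 0 j) - (1 + k) * ln (u i 0 j) - c i| <= k.
Proof.
move=> k0; have [y y0 yF] := approx_power_fixpoint k0.
pose a i := gamma i (y i).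
have a0 i : 0 < a i.
  by apply: (norm_pos (gamma_norm i) (j := Ordinal (n_gt0 i))); rewrite gt_eqF ?y0.
pose t i := - ln (a i).
have tE i : expR (t i) = (a i)^-1 by rewrite expRN lnK ?posrE.
pose u : prodspace R n := otimes (\col_i expR (t i)) y.
have uE i j : u i 0 j = expR (t i) * y i 0 j by rewrite /u /otimes !mxE.
have u0 : Kpplus u by move=> i j; rewrite uE mulr_gt0 ?expR_gt0 ?y0.
exists u; split.
  split=> //; split; first exact: Kpplus_Kplus.
  move=> i; rewrite /u /otimes mxE (norm_homog (gamma_norm i)) tE.
  by rewrite gtr0_norm ?invr_gt0// mulVf// gt_eqF.
exists (fun i => \sum_l A i l * t l - (1 + k) * t i) => i j.
rewrite F_scale ?uE//; last exact: Kpplus_Kplus.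
have Fy0 := Hd_pos FA y0.
rewrite !lnM ?posrE ?expR_gt0 ?Fy0 ?y0// !expRK.
by apply: le_trans (yF i j); rewrite le_eqVlt; apply/orP; left; apply/eqP; congr `|_|; ring.
Qed.

(** The upper inequality is exact because it feeds [CW_max_le]. The lower one has an additive error,
    since entries of [u] may tend to 0 with [e]. The bound [L] is uniform in [e], for the later
    passage to the limit. *)
Lemma approx_eigen : exists L : R, forall e, 0 < e ->
  exists (u : prodspace R n) (l : 'cV[R]_d), [/\ Spplus gamma u, forall i, 0 <= l i 0 <= L,
    forall i j, F u i 0 j <= l i 0 * u i 0 j &
    forall i j, l i 0 * u i 0 j <= F u i 0 j + e].
Proof.
(* [top] dominates every element of [Splus] entrywise, so [M] bounds all entries of [F] there. *)
pose top : prodspace R n := fun i => \row_j (gamma i (delta_mx 0 j))^-1.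
pose M := 1 + \sum_i \sum_j F top i 0 j.
have top0 : Kplus top by move=> i j; rewrite mxE invr_ge0 ltW// norm_delta_gt0.
have Ftop0 := Hd_maps FA top0.
have M0 : 0 < M by rewrite ltr_pwDl// sumr_ge0// => i _; exact: sumr_ge0.
have FM (u : prodspace R n) i j : Splus gamma u -> F u i 0 j <= M.
  move=> uS; apply: (@le_trans _ _ (F top i 0 j)).
    apply: F_le => //; first exact: uS.1.
    move=> k l; rewrite mxE -[leRHS]mul1r ler_pdivlMr ?norm_delta_gt0// -(uS.2 k).
    by rewrite -[X in X * _]ger0_norm ?uS.1//; exact: norm_ge_coord.
  rewrite /M (bigD1 i)//= (bigD1 j)//= -!addrA [leRHS]addrCA lerDl.
  rewrite !addr_ge0 ?sumr_ge0// => k _; exact: sumr_ge0.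
pose G := \sum_i \sum_j gamma i (delta_mx 0 j).
pose E2 : R := expR 2.
have E20 : 0 < E2 := expR_gt0 2.
have gd0 i j : 0 <= gamma i (delta_mx 0 j) by exact: norm_nonneg.
(* The factors bound [expR (2 * k)], the value of [F u] at the largest entry of [u i], and the
   inverse of that entry. *)
exists (E2 * M * G) => e e0.
(* The final error is [k * (M * (4 * E2 + 1))]; [k <= 1] gives [expR (2 * k) <= E2]. *)
pose k := Num.min 1 (e / (M * (4 * E2 + 1))).
have D0 : 0 < M * (4 * E2 + 1) by rewrite mulr_gt0//; lra.
have k0 : 0 < k by rewrite lt_min ltr01 divr_gt0.
have k1 : k <= 1 by rewrite ge_min lexx.
have kM : k * (M * (4 * E2 + 1)) <= e by rewrite -ler_pdivlMr// ge_min lexx orbT.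
have [u [uS [c uF]]] := approx_power_eigen k0.
have [j jP] : exists j : forall i, 'I_(n i),
    forall i j', u i 0 j' <= u i 0 (j i).
  have P i := cid (@ord_argmax R _ (fun j => u i 0 j) (n_gt0 i)).
  by exists (fun i => projT1 (P i)) => i; exact: projT2 (P i).
have u0 := uS.2; have Fu0 := Hd_pos FA u0.
pose P i := F u i 0 (j i).
have P0 i : 0 < P i := Fu0 i (j i).
have F0 i j' : 0 < F u i 0 j' := Fu0 i j'.
pose s i j' := u i 0 j' / u i 0 (j i).
have s0 i j' : 0 < s i j' by rewrite divr_gt0.
have s1 i j' : s i j' <= 1 by rewrite ler_pdivrMr// mul1r.
(* Subtracting the estimate at [j i] cancels [c i] and doubles the error. *)
have lnE i j' : `|ln (F u i 0 j') - ln (P i) - (1 + k) * ln (s i j')| <= 2 * k.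
  rewrite /s ln_div ?posrE//.
  have -> : ln (F u i 0 j') - ln (P i) - (1 + k) * (ln (u i 0 j') - ln (u i 0 (j i)))
    = (ln (F u i 0 j') - (1 + k) * ln (u i 0 j') - c i)
      - (ln (P i) - (1 + k) * ln (u i 0 (j i)) - c i) by ring.
  apply: le_trans (ler_normB _ _) _; have := uF i j'; have := uF i (j i); lra.
(* Since [s i j' <= 1], its power [1 + k] is at most [s i j']. *)
have Fup i j' : F u i 0 j' <= expR (2 * k) * (P i * s i j').
  have := lnE i j'; rewrite ler_norml => /andP[_ up].
  have ls0 : ln (s i j') <= 0 by rewrite ln_le0.
  have kls : k * ln (s i j') <= 0 by rewrite mulr_ge0_le0// ltW.
  rewrite -[leLHS]lnK ?posrE// -[P i * _]lnK ?posrE//; last exact: mulr_gt0.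
  rewrite -expRD ler_expR lnM ?posrE//.
  lra.
(* The power [1 + k] of [s] is at least [s * (1 + k * ln s)], hence at least [s - k], because
   [s * ln s >= -1]. *)
have Flow i j' : expR (- (2 * k)) * (P i * (s i j' - k)) <= F u i 0 j'.
  have := lnE i j'; rewrite ler_norml => /andP[low _].
  have low' : expR (- (2 * k)) * (P i * (s i j' * expR (k * ln (s i j')))) <= F u i 0 j'.
    rewrite -[leRHS]lnK ?posrE// -[P i]lnK ?posrE//.
    rewrite -[X in X * expR (k * _)]lnK ?posrE// -!expRD ler_expR.
    lra.
  apply: le_trans low'.
  apply: ler_wpM2l; first exact: expR_ge0.
  apply: ler_wpM2l; first exact: ltW.
  apply: (@le_trans _ _ (s i j' * (1 + k * ln (s i j')))); last first.
    by apply: ler_wpM2l (expR_ge1Dx _); exact: ltW.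
  have lns : - 1 <= s i j' * ln (s i j').
    have := expR_ge1Dx (- ln (s i j')); rewrite expRN lnK ?posrE// => h.
    have := ler_wpM2l (ltW (s0 i j')) h; rewrite mulfV ?gt_eqF//.
    have := s0 i j'; lra.
  have := ler_wpM2l (ltW k0) lns; lra.
have lE i j' : expR (2 * k) * P i / u i 0 (j i) * u i 0 j' = expR (2 * k) * (P i * s i j').
  by rewrite /s; ring.
have E2k : expR (2 * k) <= E2 by rewrite ler_expR; lra.
(* This [l] makes [l i 0 * u i 0 j'] equal to the right-hand side of [Fup]. *)
exists u, (\col_i (expR (2 * k) * P i / u i 0 (j i))); split=> //.
- move=> i; rewrite mxE; apply/andP; split.
    by rewrite divr_ge0 ?mulr_ge0 ?expR_ge0 ?ltW.
  apply: ler_pM.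
  + by rewrite mulr_ge0 ?expR_ge0//; exact: ltW.
  + by rewrite invr_ge0 ltW// u0.
  + by apply: ler_pM; [exact: expR_ge0|exact: ltW|exact: E2k|apply: FM; exact: uS.1].
  rewrite -[leLHS]mul1r ler_pdivrMr//.
  rewrite -(uS.1.2 i); apply: le_trans (norm_le_sum (gamma_norm i) _) _.
  apply: (@le_trans _ _ (\sum_j' u i 0 (j i) * gamma i (delta_mx 0 j'))).
    by apply: ler_sum => j' _; rewrite ler_wpM2r// ger0_norm// ltW// u0.
  rewrite -mulr_sumr mulrC ler_wpM2r//; first exact/ltW/u0.
  rewrite /G [leRHS](bigD1 i)//= lerDl sumr_ge0// => l _; exact: sumr_ge0.
- by move=> i j'; rewrite mxE lE.
- move=> i j'; rewrite mxE lE -lerBlDl; apply: le_trans kM.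
  apply: le_trans (lerB (lexx _) (Flow i j')) _.
  have -> : expR (2 * k) * (P i * s i j') - expR (- (2 * k)) * (P i * (s i j' - k))
    = P i * (s i j' * (expR (2 * k) - expR (- (2 * k))) + k * expR (- (2 * k))) by ring.
  rewrite mulrCA; apply: ler_pM; last 2 first.
  + by apply: FM; exact: uS.1.
  + have d4 : expR (2 * k) - expR (- (2 * k)) <= 4 * E2 * k.
      have -> : expR (- (2 * k)) = expR (2 * k) * expR (- (4 * k)).
        by rewrite -expRD; congr expR; ring.
      have := expR_ge1Dx (- (4 * k)) => h.
      have := ler_wpM2l (expR_ge0 (2 * k)) h.
      have : expR (2 * k) * (4 * k) <= E2 * (4 * k) by rewrite ler_wpM2r//; lra.
      lra.
    have d0 : 0 <= expR (2 * k) - expR (- (2 * k)) by rewrite subr_ge0 ler_expR; lra.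
    have h1 := ler_wpM2r d0 (s1 i j').
    have h2 : expR (- (2 * k)) <= 1 by rewrite -[leRHS]expR0 ler_expR; lra.
    have h3 := ler_wpM2l (ltW k0) h2.
    lra.
  + exact: ltW.
  + apply: addr_ge0; apply: mulr_ge0; rewrite ?expR_ge0 ?ltW//.
    by rewrite subr_gt0 ltr_expR; lra.
Qed.

(** The last clause takes an arbitrary real lower bound [c] of [CW_max], so that it applies to a
    finite infimum and, through weak duality, to every value of [CW_min] on [Splus]. *)
Lemma max_eigen : exists (v : prodspace R n) (l : 'cV[R]_d),
  [/\ Splus gamma v, nonneg_vec l, F v = otimes l v &
    forall c : R, (forall u, Spplus gamma u -> c <= CW_max F b u) ->
      c <= \prod_i (l i 0 `^ b i 0)].
Proof.
have [L appr] := approx_eigen.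
have e0 k : 0 < harmonic k :> R by exact: harmonic_gt0.
have [x xP] := choice (fun k => appr _ (e0 k)).
have [l lP] := choice xP.
(* Along one ultrafilter finer than [\oo] all the bounded coordinates converge simultaneously. *)
have [G [UG oG]] := @ultraFilterLemma nat \oo _.
have PG : ProperFilter G by exact: ultra_proper.
have xS k : Splus gamma (x k) by have [[]] := lP k.
have x_bnd k i j : 0 <= x k i 0 j <= (gamma i (delta_mx 0 j))^-1.
  rewrite (xS k).1 /= -[leRHS]mul1r ler_pdivlMr ?norm_delta_gt0//.
  by rewrite -((xS k).2 i) -[X in X * _]ger0_norm ?(xS k).1//; exact: norm_ge_coord.
have l_bnd k i : 0 <= l k i 0 <= L by have [_ + _ _] := lP k; exact.
pose v : prodspace R n := fun i => \row_j lim (x k i 0 j @[k --> G]).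
pose m : 'cV[R]_d := \col_i lim (l k i 0 @[k --> G]).
have xv i j : x k i 0 j @[k --> G] --> v i 0 j.
  rewrite mxE; have [p xp] := ultra_bounded_cvg UG (fun k => x_bnd k i j).
  by rewrite (cvg_lim _ xp)//; exact: norm_hausdorff.
have lm i : l k i 0 @[k --> G] --> m i 0.
  rewrite mxE; have [p xp] := ultra_bounded_cvg UG (fun k => l_bnd k i).
  by rewrite (cvg_lim _ xp)//; exact: norm_hausdorff.
have v0 : Kplus v.
  move=> i j; apply: (cvg_le (cvg_cst _) (xv i j)) => k.
  by have /andP[] := x_bnd k i j.
have m0 : nonneg_vec m.
  move=> i; apply: (cvg_le (cvg_cst _) (lm i)) => k.
  by have /andP[] := l_bnd k i.
have vS : Splus gamma v.
  split=> // i; apply: (norm_cvg_cst (gamma_norm i) (xv i)) => k; exact: (xS k).2.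
have Fxv i j : F (x k) i 0 j @[k --> G] --> F v i 0 j.
  have FcK := (subspace_continuousP _ _).1 (Hd_continuous FA) v v0.
  (* Continuity of [F] is relative to [Kplus], so the limit must be taken in the trace of the
     neighbourhood filter. *)
  have xK : x k @[k --> G] --> within Kplus (nbhs v).
    move=> U /(cvg_prodspace xv) xvU; apply: (@filterS _ G _ _ _ _ xvU) => k; apply; exact: (xS k).1.
  exact: (@cvg_coord _ _ _ _ _ _ (fun k => F (x k)) (F v) (cvg_comp x F xK FcK)).
have lxmv i j : l k i 0 * x k i 0 j @[k --> G] --> m i 0 * v i 0 j by exact: cvgM.
have harm0 : (harmonic k : R) @[k --> G] --> 0.
  by move=> U /(@cvg_harmonic R); exact: oG.
exists v, m; split=> //.
  apply: functional_extensionality_dep => i; apply/rowP => j.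
  rewrite [RHS]mxE; apply: le_anti; apply/andP; split.
    apply: (cvg_le (Fxv i j) (lxmv i j)) => k.
    by have [_ _ + _] := lP k; exact.
  rewrite -[leRHS]addr0; apply: (cvg_le (lxmv i j) (cvgD (Fxv i j) harm0)) => k.
  by have [_ _ _ +] := lP k; exact.
move=> c cP.
have lim_prod : \prod_i (l k i 0 `^ b i 0) @[k --> G] --> \prod_i (m i 0 `^ b i 0).
  apply: cvg_big => [|i _]; first exact: mul_continuous.
  by apply: powR_cvg => // k; have /andP[] := l_bnd k i.
apply: (cvg_le (cvg_cst _) lim_prod) => k; have [uS _ Fl _] := lP k.
by apply: le_trans (cP _ uS) _; apply: CW_max_le => //; exact: uS.2.
Qed.

End CollatzWielandt.

(** * The Collatz-Wielandt formula *)

Unset Implicit Arguments.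
Set Strict Implicit.
Set Printing Implicit Defensive.

Theorem theorem6p1 (R : realType) (d : nat) (n : 'I_d -> nat)
    (d_gt0 : (0 < d)%N) (n_gt0 : forall i, (0 < n i)%N)
    (gamma : forall i : 'I_d, 'rV[R]_(n i) -> R)
    (gamma_norm : forall i, is_norm (gamma i))
    (gamma_mono : forall i, monotonic_norm (gamma i))
    (F : prodspace R n -> prodspace R n) (A : 'M[R]_d) (FA : in_Hd F A)
    (b : 'cV[R]_d) (b_gt0 : forall i, 0 < b i 0)
    (b_sum1 : \sum_(i < d) b i 0 = 1)
    (Ab : A^T *m b = b \/
          (spectral_radius A < 1 /\ forall i, (A^T *m b) i 0 <= b i 0)) :
  ereal_inf [set (CW_max F b u)%:E | u in Spplus gamma] = rb gamma F b /\
  exists v, [/\ Splus gamma v,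
    (CW_min F b v)%:E = rb gamma F b &
    forall w, Splus gamma w -> CW_min F b w <= CW_min F b v].
Proof.
have Ab' k : \sum_i b i 0 * A i k <= b k 0.
  have -> : \sum_i b i 0 * A i k = (A^T *m b) k 0.
    by rewrite mxE; apply: eq_bigr => i _; rewrite mxE mulrC.
  by case: Ab => [->|[_]].
have [v [l [vS l0 Fv lmax]]] := max_eigen n_gt0 gamma_norm gamma_mono FA b_gt0 Ab'.
have weak := weak_duality n_gt0 gamma_norm gamma_mono FA b_gt0 Ab'.
set r := \prod_i (l i 0 `^ b i 0) in lmax.
have vr : CW_min F b v = r by exact: (CW_min_eigen gamma_norm vS Fv).
have infE : ereal_inf [set (CW_max F b u)%:E | u in Spplus gamma] = r%:E.
  apply/eqP; rewrite eq_le; apply/andP; split; last first.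
    by apply: le_ereal_inf_tmp => _ [u uS <-]; rewrite lee_fin -vr weak.
  have lb u : Spplus gamma u ->
      (ereal_inf [set (CW_max F b u)%:E | u in Spplus gamma] <= (CW_max F b u)%:E)%E.
    by move=> uS; apply: ereal_inf_lbound; exists u.
  move: lb; case: ereal_inf => [c| |] lb.
  - by rewrite lee_fin; apply: lmax => u /lb; rewrite lee_fin.
  (* If the infimum were [+oo], every real would be a lower bound, in particular [r + 1]. *)
  - suff : r + 1 <= r by rewrite gerDl leNgt ltr01.
    by apply: lmax => u /lb; rewrite leye_eq.
  - exact: leNye.
have rbE : rb gamma F b = r%:E.
  apply/eqP; rewrite eq_le; apply/andP; split.
    (* Each competing eigenvalue product is a value of [CW_min], hence a lower bound of [CW_max]. *)
    apply: ge_ereal_sup => _ [m [m0 [x xS Fx]] <-].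
    rewrite lee_fin -(CW_min_eigen gamma_norm xS Fx).
    by apply: lmax => u; exact: weak.
  by apply: ereal_sup_ubound; exists l => //; split=> //; exists v.
rewrite infE rbE; split=> //; exists v; split=> //; first by rewrite vr.
by move=> w wS; rewrite vr; apply: lmax => u; exact: weak.
Qed.
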